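(* Let $B_{\mathbb{C}}\colon\mathbb{O}\times\mathbb{O}\to\mathbb{C}$, $B_{\mathbb{C}}(x,y)=\operatorname{Co}(x\overline{y})$, where $\mathbb{C}=\operatorname{span}_{\mathbb{R}}\{1,e_4\}\subset\mathbb{O}$. Then $\mathcal{G}(B_{\mathbb{C}})=\operatorname{U}(4)$; that is, there is a real linear isomorphism $\varphi\colon\mathbb{O}\to\mathbb{C}^4$ such that $\mathcal{G}(B_{\mathbb{C}})=\{\varphi^{-1}\circ U\circ\varphi : U\in\operatorname{U}(4)\}$.
   Context: Let $\mathbb{H}$ be the quaternions with conjugation $a\mapsto\overline{a}$ and real part $\operatorname{Re}$. The octonions $\mathbb{O}$ are $\mathbb{H}\oplus\mathbb{H}$ with the multiplication $(a,b)(c,d)=(ac-\overline{d}b,\ da+b\overline{c})$ and the conjugation $\overline{(a,b)}=(\overline{a},-b)$. With $a\in\mathbb{H}$ identified with $(a,0)$ and $e_4=(0,1)$, one has $(a,b)=a+be_4$. The complex part is $\operatorname{Co}(a+be_4)=\operatorname{Re}(a)+\operatorname{Re}(b)e_4$. $\operatorname{GL}(\mathbb{O})$ is the group of invertible real linear maps $\mathbb{O}\to\mathbb{O}$, and for a real bilinear function $B$ on $\mathbb{O}\times\mathbb{O}$, $\mathcal{G}(B)=\{T\in\operatorname{GL}(\mathbb{O}):B(Tx,Ty)=B(x,y)\ \forall x,y\in\mathbb{O}\}$. $\operatorname{U}(4)$ is the group of unitary $4\times4$ complex matrices. *)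

(* Defs.v *)
From HB Require Import structures.
From mathcomp Require Import all_boot all_order all_algebra ring.
From mathcomp Require Import complex.
From mathcomp Require Import boolp classical_sets reals.

Set Implicit Arguments.
Unset Strict Implicit.
Unset Printing Implicit Defensive.

Import Order.TTheory GRing.Theory Num.Theory.
Local Open Scope classical_set_scope.
Local Open Scope ring_scope.
Local Open Scope complex_scope.

(* [Quat a b c d] is the quaternion a + b i + c j + d k. *)
Record quat (R : Type) := Quat { qre : R; qi : R; qj : R; qk : R }.

Section QuatChoice.
Variable R : choiceType.

Let to_prod (x : quat R) := (qre x, qi x, qj x, qk x).
Let of_prod (t : R * R * R * R) := let: (a, b, c, d) := t in Quat a b c d.

Fact quat_prodK : cancel to_prod of_prod.
Proof. by case. Qed.

HB.instance Definition _ := Choice.copy (quat R) (can_type quat_prodK).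

End QuatChoice.

Section QuatRing.
Variable R : comNzRingType.
Implicit Types x y z : quat R.

Definition quat0 : quat R := Quat 0 0 0 0.
Definition quat1 : quat R := Quat 1 0 0 0.
Definition quat_opp x := Quat (- qre x) (- qi x) (- qj x) (- qk x).
Definition quat_add x y :=
  Quat (qre x + qre y) (qi x + qi y) (qj x + qj y) (qk x + qk y).
Definition quat_scale (r : R) x := Quat (r * qre x) (r * qi x) (r * qj x) (r * qk x).
Definition quat_mul x y :=
  Quat (qre x * qre y - qi x * qi y - qj x * qj y - qk x * qk y)
       (qre x * qi y + qi x * qre y + qj x * qk y - qk x * qj y)
       (qre x * qj y - qi x * qk y + qj x * qre y + qk x * qi y)
       (qre x * qk y + qi x * qj y - qj x * qi y + qk x * qre y).

Fact quat_addA : associative quat_add.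
Proof. by move=> [????] [????] [????]; congr Quat; rewrite /= addrA. Qed.
Fact quat_addC : commutative quat_add.
Proof. by move=> [????] [????]; congr Quat; rewrite /= addrC. Qed.
Fact quat_add0 : left_id quat0 quat_add.
Proof. by move=> [????]; congr Quat; rewrite /= add0r. Qed.
Fact quat_addN : left_inverse quat0 quat_opp quat_add.
Proof. by move=> [????]; congr Quat; rewrite /= addNr. Qed.

HB.instance Definition _ :=
  GRing.isZmodule.Build (quat R) quat_addA quat_addC quat_add0 quat_addN.

Fact quat_scaleA a b x : quat_scale a (quat_scale b x) = quat_scale (a * b) x.
Proof. by congr Quat; rewrite /= mulrA. Qed.
Fact quat_scale1 : left_id 1 quat_scale.
Proof. by move=> [????]; congr Quat; rewrite /= mul1r. Qed.
Fact quat_scaleDr : right_distributive quat_scale +%R.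
Proof. by move=> ? [????] [????]; congr Quat; rewrite /= mulrDr. Qed.
Fact quat_scaleDl x : {morph quat_scale^~ x : a b / a + b}.
Proof. by move=> a b; congr Quat; rewrite /= mulrDl. Qed.

HB.instance Definition _ := GRing.Zmodule_isLmodule.Build R (quat R)
  quat_scaleA quat_scale1 quat_scaleDr quat_scaleDl.

Fact quat_mulA : associative quat_mul.
Proof. by move=> [????] [????] [????]; congr Quat; rewrite /=; ring. Qed.
Fact quat_mul1l : left_id quat1 quat_mul.
Proof. by move=> [????]; congr Quat; rewrite /=; ring. Qed.
Fact quat_mul1r : right_id quat1 quat_mul.
Proof. by move=> [????]; congr Quat; rewrite /=; ring. Qed.
Fact quat_mulDl : left_distributive quat_mul +%R.
Proof. by move=> [????] [????] [????]; congr Quat; rewrite /=; ring. Qed.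
Fact quat_mulDr : right_distributive quat_mul +%R.
Proof. by move=> [????] [????] [????]; congr Quat; rewrite /=; ring. Qed.
Fact quat_1neq0 : quat1 != 0.
Proof. by apply/eqP=> -[/eqP]; rewrite oner_eq0. Qed.

HB.instance Definition _ := GRing.Zmodule_isNzRing.Build (quat R)
  quat_mulA quat_mul1l quat_mul1r quat_mulDl quat_mulDr quat_1neq0.

Definition quat_conj x : quat R := Quat (qre x) (- qi x) (- qj x) (- qk x).

End QuatRing.

(* The alias hides the componentwise product ring structure of pairs; only
   the real vector space structure is inherited. *)
Definition oct (R : comNzRingType) : Type := (quat R * quat R)%type.

Section Octonions.
Variable R : comNzRingType.

HB.instance Definition _ := GRing.Lmodule.copy (oct R) (quat R * quat R)%type.

Implicit Types x y : oct R.

Definition oct_mul x y : oct R :=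
  let: (a, b) := x in let: (c, d) := y in
  (a * c - quat_conj d * b, d * a + b * quat_conj c).

Definition oct_conj x : oct R := let: (a, b) := x in (quat_conj a, - b).

Definition oct_of_quat (a : quat R) : oct R := (a, 0).

Definition oct1 : oct R := oct_of_quat 1.

Definition e4 : oct R := (0, 1).

Lemma octE (a b : quat R) :
  ((a, b) : oct R) = oct_of_quat a + oct_mul (oct_of_quat b) e4.
Proof.
rewrite /oct_mul /oct_of_quat /e4 mulr0 mulr0 mul1r mul0r addr0 subr0.
by congr pair; rewrite /= ?addr0 ?add0r.
Qed.

Definition Co x : oct R := qre x.1 *: oct1 + qre x.2 *: e4.

Definition Cspan : set (oct R) := [set r *: oct1 + s *: e4 | r in setT & s in setT].

Definition BC x y : oct R := Co (oct_mul x (oct_conj y)).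

(* [BC] is given the ambient space of octonions as codomain, but it takes its
   values in the copy [Cspan] of the complex numbers. *)
Lemma BC_in_Cspan x y : Cspan (BC x y).
Proof.
by exists (qre (oct_mul x (oct_conj y)).1) => //;
   exists (qre (oct_mul x (oct_conj y)).2).
Qed.

Lemma CoE x : Co x = (Quat (qre x.1) 0 0 0, Quat (qre x.2) 0 0 0).
Proof. by congr pair; congr Quat; rewrite /=; ring. Qed.

Fact BC_is_bilinear : bilinear_for *:%R *:%R BC.
Proof.
split=> [[c d] r [a b] [a' b'] | [a b] r [c d] [c' d']]; rewrite /BC !CoE;
  by congr pair; congr Quat; rewrite /=; ring.
Qed.

HB.instance Definition _ := bilinear_isBilinear.Build R (oct R) (oct R) (oct R)
  _ _ BC BC_is_bilinear.

Definition GL_oct : set (oct R -> oct R) := [set T | linear T /\ bijective T].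

Definition isometries (W : lmodType R) (B : {bilinear oct R -> oct R -> W}) :
    set (oct R -> oct R) :=
  [set T | GL_oct T /\ forall x y, B (T x) (T y) = B x y].

End Octonions.

Arguments BC {R}.

Definition unitary_group (R : realType) (n : nat) : set 'M[R[i]]_n :=
  [set U | U \is unitarymx].

Arguments unitary_group R n : clear implicits.

(* Main.v *)
Require Import Defs.
From HB Require Import structures.
From mathcomp Require Import all_boot all_order all_algebra ring.
From mathcomp Require Import complex.
From mathcomp Require Import boolp classical_sets reals.

Set Implicit Arguments.
Unset Strict Implicit.
Unset Printing Implicit Defensive.

Import Order.TTheory GRing.Theory Num.Theory.
Local Open Scope classical_set_scope.
Local Open Scope ring_scope.
Local Open Scope complex_scope.

(** Split both octonions into real quaternion coordinates: for [x = (a, b)] and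
    [y = (c, d)] one has [x * conj y = (a * conj c + conj d * b, b * c - d * a)],
    so the two components of [BC x y] are
    [\sum_l a_l c_l + b_l d_l] and
    [(b_0 c_0 - a_0 d_0) - \sum_(l > 0) (b_l c_l - a_l d_l)].
    Each summand is the real or imaginary part of a product [z_l * conj w_l],
    where [z_0 = a_0 + i b_0] but [z_l = a_l - i b_l] for [l > 0], and [w] comes
    from [y] in the same way. In the coordinates [z] ([oct_col]) the form [BC] is
    therefore the standard Hermitian form of [C^4] ([herm_oct_col]).

    It remains to see that the maps preserving the standard Hermitian form are
    exactly the unitary matrices. A preserving map [f] sends the standard basis
    to an orthonormal basis, hence the matrix [U] of those images is unitary, and
    the coordinates of [f u] in that basis are those of [u] in the standard one,
    i.e. [f u = U u] ([herm_preserving_unitary]). The complex linearity of the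
    isometries of [BC] thus comes from the form: their definition only mentions
    real linearity. *)

Section HermitianForm.
Variables (C : numClosedFieldType) (n : nat).
Local Open Scope sesquilinear_scope.
Implicit Types (u v : 'cV[C]_n) (U : 'M[C]_n).

Definition herm u v : C := (v ^t* *m u) 0 0.

Lemma unitarymxPl U : reflect (U ^t* *m U = 1%:M) (U \is unitarymx).
Proof. by apply: (iffP unitarymxP) => /mulmx1C. Qed.

Lemma herm_unitary U u v :
  U \is unitarymx -> herm (U *m u) (U *m v) = herm u v.
Proof.
move=> /unitarymxPl UU.
by rewrite /herm trmx_mul map_mxM mulmxA -[_ *m _ *m U]mulmxA UU mulmx1.
Qed.

Lemma herm_delta u i : herm u (delta_mx i 0) = u i 0.
Proof. by rewrite /herm trmx_delta map_delta_mx -rowE mxE. Qed.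

(** Let [U] have the columns [f (delta_mx j 0)]. The [j]-th entry of [U ^t* *m f u]
    is [herm (f u) (f (delta_mx j 0)) = herm u (delta_mx j 0) = u j 0], so
    [U ^t* *m f u = u] for every [u]. Taking the basis vectors for [u] gives
    [U ^t* *m U = 1], and then [f u = U *m (U ^t* *m f u) = U *m u]. *)
Lemma herm_preserving_unitary (f : 'cV[C]_n -> 'cV[C]_n) :
    (forall u v, herm (f u) (f v) = herm u v) ->
  exists2 U, U \is unitarymx & f =1 mulmx U.
Proof.
move=> f_herm; pose U : 'M[C]_n := \matrix_(i, j) f (delta_mx j 0) i 0.
have colU j : col j U = f (delta_mx j 0).
  by apply/colP => i; rewrite !mxE.
have adjU_f u : U ^t* *m f u = u.
  apply/colP => i; rewrite -[RHS]herm_delta -f_herm -colU /herm.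
  by rewrite tr_col map_row -row_mul [RHS]mxE.
have U_unitary : U \is unitarymx.
  apply/unitarymxPl/matrixP => i k.
  transitivity (col k (U ^t* *m U) i 0); first by rewrite [RHS]mxE.
  by rewrite colE -mulmxA -colE colU adjU_f !mxE andbT.
exists U => // u.
by rewrite -{2}[u]adjU_f mulmxA (unitarymxP U_unitary) mul1mx.
Qed.

End HermitianForm.

Section Coordinates.
Variable R : realType.

(** The sign of the imaginary part changes after the first coordinate because
    [Re (b * c)] pairs the imaginary units of the quaternions negatively. *)
Definition oct_col (x : oct R) : 'cV[R[i]]_4 :=
  \col_i [:: qre x.1 +i* qre x.2; qi x.1 -i* qi x.2;
             qj x.1 -i* qj x.2; qk x.1 -i* qk x.2]`_i.

Definition col_oct (u : 'cV[R[i]]_4) : oct R :=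
  let z i := u (inord i) 0 in
  let re i := complex.Re (z i) in
  let im i := complex.Im (z i) in
  (Quat (re 0) (re 1) (re 2) (re 3),
   Quat (im 0) (- im 1) (- im 2) (- im 3)).

Lemma oct_colK : cancel oct_col col_oct.
Proof.
by case=> [[????] [????]]; rewrite /col_oct !mxE !inordK //= !opprK.
Qed.

Lemma col_octK : cancel col_oct oct_col.
Proof.
move=> u; apply/colP => i; rewrite mxE -[i in RHS]inord_val.
case: i => -[|[|[|[|//]]]] /= _; rewrite ?opprK; by case: (u _ _).
Qed.

Fact oct_col_is_linear :
  GRing.linear_for (real_complex R \; *:%R) oct_col.
Proof.
move=> r [[????] [????]] [[????] [????]]; apply/colP => i; rewrite !mxE.
by case: i => -[|[|[|[|//]]]] /= _; congr Complex; rewrite /=; ring.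
Qed.

HB.instance Definition _ := GRing.isLinear.Build R (oct R) 'cV[R[i]]_4
  (real_complex R \; *:%R) oct_col oct_col_is_linear.

Lemma herm_oct_col x y :
  herm (oct_col x) (oct_col y) = qre (BC x y).1 +i* qre (BC x y).2.
Proof.
case: x y => [[????] [????]] [[????] [????]].
rewrite /herm mxE !big_ord_recl big_ord0 !mxE /BC CoE /=.
by congr Complex; rewrite /=; ring.
Qed.

(** [BC] takes octonion values and [herm] complex ones; comparing equalities of
    values avoids naming the identification of [span(1, e4)] with [C]. *)
Lemma BC_eq_herm x y x' y' :
  BC x y = BC x' y' <->
  herm (oct_col x) (oct_col y) = herm (oct_col x') (oct_col y').
Proof.
have BC_herm u v (h := herm (oct_col u) (oct_col v)) :
    BC u v = (Quat (complex.Re h) 0 0 0, Quat (complex.Im h) 0 0 0).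
  by rewrite /h herm_oct_col /BC CoE.
by split=> e; [rewrite !herm_oct_col e | rewrite BC_herm e -BC_herm].
Qed.

End Coordinates.

Theorem mainTheorem6 (R : realType) :
  exists (phi : {linear oct R -> 'cV[R[i]]_4 | real_complex R \; *:%R})
         (phi_inv : 'cV[R[i]]_4 -> oct R),
    [/\ cancel phi phi_inv, cancel phi_inv phi &
        isometries BC =
          [set phi_inv \o mulmx U \o phi | U in unitary_group R 4]].
Proof.
exists (@oct_col R : {linear _ -> _ | _}), (@col_oct R).
split; [exact: oct_colK | exact: col_octK |].
apply/seteqP; split=> [T [_ T_BC] | _ [U /= U_unitary <-]] /=.
  have [u v|U U_unitary TU] :=
      @herm_preserving_unitary _ _ (@oct_col R \o T \o @col_oct R).
    rewrite -[u in RHS]col_octK -[v in RHS]col_octK;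
    by apply/BC_eq_herm; exact: T_BC.
  by exists U => //; apply/funext => x /=; rewrite -TU /= !oct_colK.
split=> [|x y]; last first.
  by apply/BC_eq_herm; rewrite /= !col_octK herm_unitary.
split.
  move=> r x y; apply: (can_inj (@oct_colK R)).
  by rewrite /= !oct_col_is_linear !col_octK linearP.
exists (@col_oct R \o mulmx (invmx U) \o @oct_col R) => x /=;
  by rewrite col_octK ?mulKmx ?mulKVmx ?oct_colK ?unitarymx_unit.
Qed.
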